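(* Let $R$ be a complete intersection SAGA of codimension $n+1$ presented by quadrics, let $k\ge2$, and let $\pi\subseteq\mathbb P(R^1)$ be a $(k-1)$-dimensional linear subspace contained in $\mathcal N_{k+1}$. Then: (A) $T_k:=\pi\cap\mathcal N_k$ is a hypersurface of degree $k$ in $\pi$ (the zero locus of a nonzero homogeneous form of degree $k$ on $\pi$, possibly with multiple components); (B) there exist $[x_0],\dots,[x_{k-1}]\in T_k$ with $x_0,\dots,x_{k-1}$ linearly independent and $\prod_{i=0}^{k-1}x_i\neq0$. In particular $T_k$ is non-degenerate in $\pi$ and $\pi\subseteq\mathrm{Sec}^k(\mathcal N_k)$.
   Context: $\mathbb K$ is an algebraically closed field of characteristic $0$. A complete intersection SAGA of codimension $n+1$ presented by quadrics is $R=S/I$ with $S=\mathbb K[x_0,\dots,x_n]$ and $I$ generated by a regular sequence of $n+1$ homogeneous quadrics. $\mathcal N_k=\{[x]\in\mathbb P(R^1)\mid x^k=0\}$. For nonempty $X\subseteq\mathbb P^r$, $\mathrm{Sec}^k(X)$ is the closure of $\bigcup_{p_1,\dots,p_k\in X}\langle p_1,\dots,p_k\rangle$, where $\langle\cdot\rangle$ denotes linear span. *)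

(* Defs.v *)
From HB Require Import structures.
From mathcomp Require Import all_boot all_order all_algebra.
From mathcomp Require Export mpoly.
Set Implicit Arguments. Unset Strict Implicit. Unset Printing Implicit Defensive.
Import Order.TTheory GRing.Theory.
Local Open Scope ring_scope.

Section Defs.
Variables (K : fieldType) (N m : nat).

Definition in_ideal_prefix (g : 'I_m -> {mpoly K[N]}) (j : nat)
    (p : {mpoly K[N]}) : Prop :=
  exists c : 'I_m -> {mpoly K[N]}, p = \sum_(i < m | (i < j)%N) c i * g i.

Definition in_ideal (g : 'I_m -> {mpoly K[N]}) (p : {mpoly K[N]}) : Prop :=
  in_ideal_prefix g m p.

Definition regular_sequence (g : 'I_m -> {mpoly K[N]}) : Prop :=
  (forall (j : 'I_m) (p : {mpoly K[N]}),
      in_ideal_prefix g j (g j * p) -> in_ideal_prefix g j p)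
  /\ ~ in_ideal g 1.
End Defs.

Definition linform (K : fieldType) (N : nat) (v : 'rV[K]_N) : {mpoly K[N]} :=
  \sum_(i < N) v 0 i *: 'X_i.

(* [v] in P(R^1) lies in N_k = { [x] | x^k = 0 in R = S/(q) } *)
Definition in_Nk (K : fieldType) (N m : nat) (q : 'I_m -> {mpoly K[N]})
    (k : nat) (v : 'rV[K]_N) : Prop :=
  v != 0 /\ in_ideal q (linform v ^+ k).

(* Main.v *)
Require Import Defs.
From HB Require Import structures.
From mathcomp Require Import all_boot all_order all_algebra.
From mathcomp Require Import mpoly.
From Stdlib Require Import ClassicalEpsilon.
Import Order.TTheory GRing.Theory.
Set Implicit Arguments. Unset Strict Implicit. Unset Printing Implicit Defensive.
Local Open Scope ring_scope.

(* Write [I] for the ideal of the quadrics, [R = S/I] and [V] for the [k]-dimensional space of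
   linear forms. Polarizing [x^{k+1} = 0] shows that [V] kills [V^k] in [R]. The annihilator of
   [V = <x_1, ..., x_k>] in degree [d] of [R] embeds in the part of coefficient degree [d - k] of
   the Koszul homology [H_k(q; S/(x_1, ..., x_k))]: one passes from [H_l(q; S/(x_1, ..., x_l))]
   to [l + 1] by writing [x_{l+1} z = d z'], which lowers coefficient degrees by one. Hence this
   annihilator vanishes for [d < k]. For [d = k] it consists of constant cycles, that is, of
   [Lambda^k] of the space of quadrics of [I] lying in [(V)]; as
   [H_{k+1}(q; S/(x_1, ..., x_k)) = 0], this space has dimension at most [k], so the annihilator
   is at most a line. Therefore [x^k = F(x) w] on [V] for a form [F] of degree [k], and [F] is
   nonzero because [V^k = 0] would descend to [1 = 0].
   For the basis, start from a nonzero product of [k] elements of [V] and replace its factors one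
   at a time by zeros of [F] outside the span of the previous ones: if [y <> 0] makes the product
   vanish, a generic line [v + s y] meets [F = 0], since [y V^{k-1} <> 0], and moving along it
   does not change the product. *)

(** * The Koszul complex and its acyclicity for regular sequences *)

Section Koszul.
Variable S : comNzRingType.
Implicit Types (L : S -> Prop) (gs xs : seq S).

Record ideal L : Prop := Ideal {
  ideal0 : L 0;
  idealD : forall a b, L a -> L b -> L (a + b);
  idealM : forall r a, L a -> L (r * a) }.

Lemma idealN L a : ideal L -> L a -> L (- a).
Proof. by move=> hL /(idealM hL (-1)); rewrite mulN1r. Qed.

Lemma idealB L a b : ideal L -> L a -> L b -> L (a - b).
Proof. by move=> hL ha hb; apply: idealD => //; apply: idealN. Qed.

Fixpoint idl gs (p : S) : Prop :=
  if gs is g :: gs' then exists a, idl gs' (p - a * g) else p = 0.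

(* Sequences are listed in reverse: the head is the last element of the regular sequence. *)
Fixpoint reg gs : Prop :=
  if gs is g :: gs' then reg gs' /\ (forall p, idl gs' (g * p) -> idl gs' p)
  else True.

Lemma idl_ideal gs : ideal (idl gs).
Proof.
elim: gs => [|g gs IH]; split=> /=.
- by [].
- by move=> a b -> ->; rewrite addr0.
- by move=> r a ->; rewrite mulr0.
- by exists 0; rewrite mul0r subr0; apply: ideal0.
- move=> a b [c hc] [e he]; exists (c + e).
  by rewrite mulrDl opprD addrACA; apply: idealD.
- move=> r a [c hc]; exists (r * c).
  by rewrite -mulrA -mulrBr; apply: idealM.
Qed.
Hint Resolve idl_ideal : core.

Lemma idl_cons g gs p : idl gs p -> idl (g :: gs) p.
Proof. by move=> h; exists 0; rewrite mul0r subr0. Qed.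

Lemma idl_head g gs a : idl (g :: gs) (a * g).
Proof. by exists a; rewrite subrr; apply: ideal0. Qed.

(* [KC p m] is the degree [p] part of the Koszul complex on [m] elements: an element [(u, v)]
   of [KC p.+1 m.+1] stands for [u + e /\ v], with [e] the last basis vector. *)
Fixpoint KC (p : nat) : nat -> lmodType S :=
  match p with
  | 0 => fun=> S^o
  | p'.+1 => fix aux (m : nat) : lmodType S :=
     match m with 0 => 'rV[S]_0 | m'.+1 => (aux m' * KC p' m')%type end
  end.

(** For an ideal [L] this is congruence of [z] to zero modulo [L]; it replaces Koszul complexes over
    quotient rings. *)
Fixpoint KAll L (p : nat) : forall m, KC p m -> Prop :=
  match p with
  | 0 => fun _ z => L z
  | p'.+1 => fix aux (m : nat) : KC p'.+1 m -> Prop :=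
     match m with
     | 0 => fun=> True
     | m'.+1 => fun z => aux m' z.1 /\ KAll L z.2
     end
  end.

(** The rule is [d (u + e /\ v) = d u + g v - e /\ d v]; the last term is absent in lowest
    degree. *)
Fixpoint dK gs (p : nat) : KC p.+1 (size gs) -> KC p (size gs) :=
  match gs with
  | [::] => fun=> 0
  | g :: gs' =>
    match p return KC p.+1 (size gs').+1 -> KC p (size gs').+1 with
    | 0 => fun z => @dK gs' 0 z.1 + g *: z.2
    | p'.+1 => fun z => (@dK gs' p'.+1 z.1 + g *: z.2, - @dK gs' p' z.2)
    end
  end.
Arguments dK gs {p} z.

Lemma KC00 p (z : KC p.+1 0) : z = 0.
Proof. by apply/matrixP => i []. Qed.

Lemma KC_cons p m (z : KC p.+1 m.+1) :
  exists (u : KC p.+1 m) (v : KC p m), z = (u, v).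
Proof. by case: z => u v; exists u, v. Qed.

Lemma KAll_zero L p m : L 0 -> KAll L (0 : KC p m).
Proof.
move=> h0; elim: p m => [|p IHp] m //=.
by elim: m => [|m IHm] //=.
Qed.

Lemma KAll_add L p m (y z : KC p m) : (forall a b, L a -> L b -> L (a + b)) ->
  KAll L y -> KAll L z -> KAll L (y + z).
Proof.
move=> hL; elim: p m y z => [|p IHp] m; first by move=> y z; apply: hL.
elim: m => [|m IHm] //= [y1 y2] [z1 z2] /= [? ?] [? ?].
by split; [apply: IHm | apply: IHp].
Qed.

Lemma KAll_scale L L' r p m (z : KC p m) : (forall a, L a -> L' (r * a)) ->
  KAll L z -> KAll L' (r *: z).
Proof.
move=> hL; elim: p m z => [|p IHp] m; first by move=> z; apply: hL.
elim: m => [|m IHm] //= [z1 z2] /= [? ?].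
by split; [apply: IHm | apply: IHp].
Qed.

Lemma KAll_opp L L' p m (z : KC p m) : (forall a, L a -> L' (- a)) ->
  KAll L z -> KAll L' (- z).
Proof.
by move=> hL; rewrite -scaleN1r; apply: KAll_scale => a /hL; rewrite mulN1r.
Qed.

Lemma KAll0 L p m : ideal L -> KAll L (0 : KC p m).
Proof. by move=> [h0 _ _]; apply: KAll_zero. Qed.

Lemma KAllD L p m (y z : KC p m) : ideal L -> KAll L y -> KAll L z -> KAll L (y + z).
Proof. by move=> [_ hD _]; apply: KAll_add. Qed.

Lemma KAllZ L p m r (z : KC p m) : ideal L -> KAll L z -> KAll L (r *: z).
Proof. by move=> [_ _ hM]; apply/KAll_scale/hM. Qed.

Lemma KAllN L p m (z : KC p m) : ideal L -> KAll L z -> KAll L (- z).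
Proof. by move=> hL hz; rewrite -scaleN1r; apply: KAllZ. Qed.

Lemma KAllB L p m (y z : KC p m) : ideal L -> KAll L y -> KAll L z -> KAll L (y - z).
Proof. by move=> hL hy hz; apply: KAllD => //; apply: KAllN. Qed.

Lemma KAll_impl L L' p m (z : KC p m) :
  (forall s, L s -> L' s) -> KAll L z -> KAll L' z.
Proof.
move=> h; elim: p m z => [|p IHp] m; first by move=> z; apply: h.
elim: m => [|m IHm] //= [z1 z2] /= [? ?].
by split; [apply: IHm | apply: IHp].
Qed.

Lemma KAll_eq0 p m (z : KC p m) : KAll (fun s => s = 0) z -> z = 0.
Proof.
elim: p m z => [|p IHp] m //.
elim: m => [|m IHm] /=; first by move=> z _; apply: KC00.
by move=> [z1 z2] /= [/IHm -> /IHp ->].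
Qed.

Lemma KAll_split L x p m (z : KC p m) :
  KAll (fun s => exists a, L (s - a * x)) z ->
  exists y, KAll L (z - x *: y).
Proof.
elim: p m z => [|p IHp] m; first by move=> z [a ha]; exists a; rewrite /GRing.scale /= mulrC.
elim: m => [|m IHm] /=; first by move=> z _; exists 0.
move=> [z1 z2] /= [/IHm[y1 h1] /IHp[y2 h2]].
by exists (y1, y2).
Qed.

Lemma KAll_nzd L x p m (z : KC p m) :
  (forall s, L (x * s) -> L s) -> KAll L (x *: z) -> KAll L z.
Proof.
move=> h; elim: p m z => [|p IHp] m; first by move=> z; apply: h.
elim: m => [|m IHm] //= [z1 z2] /= [? ?].
by split; [apply: IHm | apply: IHp].
Qed.

Lemma KAll_idl_scale x xs p m (z : KC p m) : KAll (idl (x :: xs)) (x *: z).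
Proof.
elim: p m z => [|p IHp] m.
  by move=> z; have := idl_head x xs z; rewrite /GRing.scale /= mulrC.
elim: m => [|m IHm] //= [z1 z2]; split; [exact: IHm | exact: IHp].
Qed.

Lemma dK_is_linear gs p : linear (@dK gs p).
Proof.
elim: gs p => [|g gs IH] [|p] a y z /=; rewrite ?scaler0 ?addr0 //.
  rewrite IH; case: y z => [y1 y2] [z1 z2] /=.
  rewrite scalerDr !scalerA scalerDr scalerA [a * g]mulrC; exact: addrACA.
rewrite !IH; case: y z => [y1 y2] [z1 z2] /=; congr (_, _) => /=.
  rewrite scalerDr !scalerA scalerDr scalerA [a * g]mulrC; exact: addrACA.
by rewrite opprD scalerN.
Qed.

HB.instance Definition _ gs p :=
  GRing.isLinear.Build S (KC p.+1 (size gs)) (KC p (size gs)) _ (@dK gs p)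
    (@dK_is_linear gs p).

Lemma dK_dK gs p (z : KC p.+2 (size gs)) : dK gs (dK gs z) = 0.
Proof.
elim: gs p z => [|g gs IH] [|p] //= [z1 z2] /=.
  by rewrite linearD linearZ /= IH add0r scalerN subrr.
rewrite linearD linearZ /= !IH add0r scalerN subrr.
by rewrite linearN /= IH oppr0 oppr0.
Qed.

Lemma dK_KAll L gs p (z : KC p.+1 (size gs)) : ideal L -> KAll L z -> KAll L (dK gs z).
Proof.
move=> hL; elim: gs p z => [|g gs IH] [|p].
- by move=> z _; apply: (@KAll0 L 0 0).
- by move=> z _; apply: (@KAll0 L p.+1 0).
- move=> [z1 z2] /= [h1 h2]; apply: idealD => //; first exact: (IH 0%N).
  exact: idealM.
- move=> [z1 z2] [h1 h2]; split.
    by apply: KAllD => //; [apply: (IH p.+1) | apply: KAllZ].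
  by apply: KAllN => //; apply: IH.
Qed.

Lemma idl_dK gs s : idl gs s <-> exists z : KC 1 (size gs), s = dK gs z.
Proof.
elim: gs s => [|g gs IH] s /=.
  by split=> [->|[_ ->]//]; exists 0.
split=> [[a /IH[z hz]]|[[z1 z2] /= ->]].
  by exists (z, a); rewrite /= -hz /GRing.scale /= [g * a]mulrC subrK.
by exists z2; rewrite /GRing.scale /= [g * z2]mulrC addrK; apply/IH; exists z1.
Qed.

(** In a cycle [u + e /\ v] the part [v] is some [d w], by induction or, in degree zero, by
    regularity of [g]. Then [u + g w] is a cycle for the shorter sequence, hence some [d t], and the
    given cycle is the boundary of [t - e /\ w]. *)
Lemma koszul_exact gs p (z : KC p.+1 (size gs)) :
  reg gs -> dK gs z = 0 -> exists w : KC p.+2 (size gs), z = dK gs w.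
Proof.
elim: gs p z => [|g gs IH] p z.
  by move=> _ _; exists 0; rewrite [z]KC00 [RHS]KC00.
move=> [hr hg].
have fin (u : KC p.+1 (size gs)) (v : KC p (size gs)) (w : KC p.+1 (size gs)) :
    v = dK gs w -> dK gs u + g *: v = 0 ->
    exists w : KC p.+2 (size (g :: gs)), (u, v) = dK (g :: gs) w.
  move=> hv hu.
  have [t ht] : exists t : KC p.+2 (size gs), u + g *: w = dK gs t.
    by apply: IH => //; rewrite linearD linearZ; rewrite hv in hu.
  by exists (t, - w); rewrite hv /= -ht scalerN addrK linearN opprK.

case: z => u v.
case: p u v fin => [|p] u v fin /= hd.
  have /idl_dK[w hw] : idl gs v.
    apply: hg; apply/idl_dK; exists (- u).
    by rewrite linearN /=; apply/eqP; rewrite -addr_eq0 addrC; apply/eqP.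
  exact: (fin _ _ w).
case: hd => hu /eqP; rewrite oppr_eq0 => /eqP hv.
have [w hw] := IH p v hr hv.
exact: (fin _ _ w).
Qed.

(** Vanishing of [H_i(gs; S/(xs))] for [i] above the length of [xs]. If [d z = x b] modulo the
    shorter ideal, regularity of [x] makes [b] a cycle there, so [b = d w] by induction; then
    [z - x w] is a cycle there too, hence a boundary. *)
Lemma koszul_exact_mod gs xs p (z : KC p.+1 (size gs)) :
  reg gs -> reg xs -> (size xs <= p)%N -> KAll (idl xs) (dK gs z) ->
  exists w : KC p.+2 (size gs), KAll (idl xs) (z - dK gs w).
Proof.
move=> hg; elim: xs p z => [|x xs IH] p z.
  move=> _ _ /KAll_eq0 /(koszul_exact hg)[w ->].
  by exists w; rewrite subrr; apply: KAll0.
move=> [hxs hx]; case: p z => [//|p] z /= hp hz.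
have [b hb] := KAll_split hz.
have [w hw] : exists w : KC p.+2 (size gs), KAll (idl xs) (b - dK gs w).
  apply: IH => //; apply: KAll_nzd hx _.
  have := dK_KAll (idl_ideal xs) hb.
  by rewrite linearB linearZ /= dK_dK sub0r => /(KAllN (idl_ideal xs)); rewrite opprK.
have [t ht] : exists t, KAll (idl xs) (z - x *: w - dK gs t).
  apply: IH => //; first exact: ltnW.
  rewrite linearB linearZ /=.
  have -> : dK gs z - x *: dK gs w = (dK gs z - x *: b) + x *: (b - dK gs w).
    by rewrite scalerBr addrA subrK.
  by apply: KAllD => //; apply: KAllZ.
exists t.
have -> : z - dK gs t = (z - x *: w - dK gs t) + x *: w by rewrite addrAC subrK.
apply: KAllD; first exact: (idl_ideal (x :: xs)).
  exact: KAll_impl (@idl_cons x xs) ht.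
exact: KAll_idl_scale.
Qed.
End Koszul.
Arguments dK {S} gs {p} z.
#[local] Hint Resolve idl_ideal : core.

(** * Coefficientwise maps on the Koszul complex *)

Section KoszulMap.
Variable S : comNzRingType.
Implicit Types (L : S -> Prop) (gs : seq S).

Fixpoint Kmap (f : S -> S) (p : nat) : forall m, KC S p m -> KC S p m :=
  match p with
  | 0 => fun _ z => f z
  | p'.+1 => fix aux (m : nat) : KC S p'.+1 m -> KC S p'.+1 m :=
     match m with
     | 0 => id
     | m'.+1 => fun z => (aux m' z.1, Kmap f z.2)
     end
  end.

Lemma KmapD (f : {additive S -> S}) p m (y z : KC S p m) :
  Kmap f (y + z) = Kmap f y + Kmap f z.
Proof.
elim: p m y z => [|p IHp] m; first by move=> y z; apply: raddfD.
elim: m => [|m IHm] //= [y1 y2] [z1 z2] /=.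
by congr (_, _); [apply: IHm | apply: IHp].
Qed.

Lemma KmapN (f : {additive S -> S}) p m (z : KC S p m) : Kmap f (- z) = - Kmap f z.
Proof.
elim: p m z => [|p IHp] m; first by move=> z; apply: raddfN.
elim: m => [|m IHm] //= [z1 z2] /=.
by congr (_, _); [apply: IHm | apply: IHp].
Qed.

Lemma KmapB (f : {additive S -> S}) p m (y z : KC S p m) :
  Kmap f (y - z) = Kmap f y - Kmap f z.
Proof. by rewrite KmapD KmapN. Qed.

Lemma KAll_Kmap L L' (f : S -> S) p m (z : KC S p m) :
  (forall s, L s -> L' (f s)) -> KAll L z -> KAll L' (Kmap f z).
Proof.
move=> h; elim: p m z => [|p IHp] m; first by move=> z; apply: h.
elim: m => [|m IHm] //= [z1 z2] /= [? ?].
by split; [apply: IHm | apply: IHp].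
Qed.

Lemma KAll_true L p m (z : KC S p m) : (forall s, L s) -> KAll L z.
Proof.
move=> h; elim: p m z => [|p IHp] m //=.
by elim: m => [|m IHm] //= [z1 z2]; split; [apply: IHm | apply: IHp].
Qed.

Lemma Kmap_id (f : S -> S) p m (z : KC S p m) : KAll (fun s => f s = s) z -> Kmap f z = z.
Proof.
elim: p m z => [|p IHp] m //.
elim: m => [|m IHm] //= [z1 z2] /= [/IHm h1 /IHp h2].
by congr (_, _).
Qed.

Lemma Kmap_scale x (f f' : S -> S) p m (z : KC S p m) :
  (forall s, f (x * s) = x * f' s) -> Kmap f (x *: z) = x *: Kmap f' z.
Proof.
move=> h; elim: p m z => [|p IHp] m; first by move=> z; apply: h.
elim: m => [|m IHm] /=; first by move=> z; apply/matrixP => i [].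
by move=> [z1 z2] /=; congr (_, _); [apply: IHm | apply: IHp].
Qed.

(** Meant for quadrics [gs], with [f] and [f'] the projections onto degrees [e + 2] and [e], or with
    [f'] zero when [f] projects onto degree 0 or 1. *)
Lemma Kmap_dK (f : {additive S -> S}) (f' : S -> S) gs p (z : KC S p.+1 (size gs)) :
  (forall g s, g \in gs -> f (g * s) = g * f' s) ->
  Kmap f (dK gs z) = dK gs (Kmap f' z).
Proof.
elim: gs p z => [|g gs IH] [|p] z h.
- exact: raddf0.
- by apply/matrixP => i [].
- have [z1 [z2 ->]] := KC_cons z; rewrite /= -(IH 0%N).
    by rewrite (raddfD f) /GRing.scale /= h ?mem_head.
  by move=> g' s hg'; apply: h; rewrite inE hg' orbT.
- have h' g' s : g' \in gs -> f (g' * s) = g' * f' s.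
    by move=> hg'; apply: h; rewrite inE hg' orbT.
  have [z1 [z2 ->]] := KC_cons z.
  have e := Kmap_scale z2 (h g ^~ (mem_head g gs)).
  have e1 := KmapD f (dK gs z1) (g *: z2).
  have e2 := KmapN f (dK gs z2).
  by congr (_, _); [rewrite e (IH p.+1 z1 h') in e1 | rewrite (IH p z2 h') in e2].
Qed.

Lemma Kmap_cst0 p m (z : KC S p m) : Kmap (fun=> 0) z = 0.
Proof.
elim: p m z => [|p IHp] m //.
elim: m => [|m IHm] /=; first by move=> z; apply/matrixP => i [].
by move=> [z1 z2] /=; congr (_, _); [apply: IHm | apply: IHp].
Qed.
End KoszulMap.

(** * Homogeneous components and homogeneous ideals *)

Section Grading.
Variables (K : fieldType) (N : nat).
Local Notation S := {mpoly K[N]}.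
Implicit Types (gs xs : seq S).

Lemma pihomogMl d e (g s : S) : g \is d.-homog ->
  pihomog mdeg (d + e) (g * s) = g * pihomog mdeg e s.
Proof.
move=> hg.
rewrite {1}(pihomog_partitionE (leqnn (mmeasure mdeg s))) mulr_sumr raddf_sum /=.
have hi i : g * pihomog mdeg i s \is (d + i).-homog by rewrite dhomogM ?pihomogP.
case: (ltnP e (mmeasure mdeg s)) => he.
  rewrite (bigD1 (Ordinal he)) //= pihomog_dE // big1 ?addr0 // => i hne.
  apply: pihomog_ne0 (hi i); rewrite eqn_add2l.
  by apply: contra hne => /eqP e0; apply/eqP/val_inj.
rewrite big1 => [|i _]; last first.
  by apply: pihomog_ne0 (hi i); rewrite eqn_add2l ltn_eqF // (leq_trans _ he).
rewrite pihomogE big_seq_cond big_pred0 ?mulr0 // => m.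
apply/negP => /andP[hm /eqP hme].
by move: (mmeasure_mnm_lt mdeg hm); rewrite hme ltnNge he.
Qed.

Lemma pihomogMl0 d e (g s : S) : g \is d.-homog -> (e < d)%N ->
  pihomog mdeg e (g * s) = 0.
Proof.
move=> hg he.
rewrite {1}(pihomog_partitionE (leqnn (mmeasure mdeg s))) mulr_sumr raddf_sum /=.
rewrite big1 // => i _.
apply: (@pihomog_ne0 _ _ _ (d + i)%N); last by rewrite dhomogM ?pihomogP.
by rewrite gtn_eqF // (leq_trans he) // leq_addr.
Qed.

Lemma dhomog0_const (s : S) : s \is 0.-homog -> exists c, s = c%:MP.
Proof.
move=> hs; exists s@_0; apply/mpolyP => m; rewrite mcoeffC.
have [->|hm] := eqVneq m 0%MM; first by rewrite mulr1.
by rewrite mulr0 (dhomog_nemf_coeff hs) //= mdeg_eq0.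
Qed.

Lemma idl_pihomog d gs e (s : S) : all (fun g => g \is d.-homog) gs ->
  idl gs s -> idl gs (pihomog mdeg e s).
Proof.
elim: gs s => [|g gs IH] s /=; first by move=> _ ->; apply: raddf0.
case/andP=> hg hgs [a /(IH _ hgs)].
rewrite raddfB /= mulrC; case: (ltnP e d) => hed.
  by rewrite (pihomogMl0 _ hg hed) subr0 => h; apply: idl_cons.
rewrite -{2}(subnKC hed) (pihomogMl _ _ hg) mulrC => h.
by exists (pihomog mdeg (e - d) a).
Qed.

Lemma idl_pihomog0 d gs e (s : S) : all (fun g => g \is d.-homog) gs -> (e < d)%N ->
  idl gs s -> pihomog mdeg e s = 0.
Proof.
move=> + hed; elim: gs s => [|g gs IH] s /=; first by move=> _ ->; apply: raddf0.
case/andP=> hg hgs [a /(IH _ hgs)].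
by rewrite raddfB /= mulrC (pihomogMl0 _ hg hed) subr0.
Qed.
End Grading.

(** * Raising the Koszul degree by dividing out one linear form at a time *)

Section Zigzag.
Variables (K : fieldType) (N : nat).
Local Notation S := {mpoly K[N]}.
Implicit Types (gs xs ys : seq S).

Definition Khom e p m (z : KC S p m) : Prop := KAll (fun s : S => s \is e.-homog) z.

(* The Koszul differential of quadrics raises degrees by two, so a lift can be taken one degree
   lower; below degree one it can be taken to be zero. *)
Lemma zigzag_lift gs xs y e p (z : KC S p (size gs)) (w : KC S p.+1 (size gs)) :
  all (fun g => g \is 2.-homog) gs -> all (fun x => x \is 1.-homog) xs ->
  y \is 1.-homog -> Khom e z -> KAll (idl xs) (y *: z - dK gs w) ->
  exists w', [/\ Khom e.-1 w', KAll (idl xs) (y *: z - dK gs w') & e = 0%N -> w' = 0].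
Proof.
move=> hg hx hy hz /(KAll_Kmap (f := pihomog mdeg e.+1) (L' := idl xs)) h.
have {h} := h (fun s => @idl_pihomog _ _ 1 xs e.+1 s hx).
rewrite KmapB (Kmap_scale (f' := pihomog mdeg e)); last first.
  by move=> s; rewrite -(pihomogMl _ _ hy).
rewrite (Kmap_id (f := pihomog mdeg e)); last first.
  by apply: KAll_impl hz => s; apply: pihomog_dE.
case: e hz => [|e] hz.
  rewrite (Kmap_dK (f' := fun=> 0)); last first.
    by move=> g s /(allP hg) hgs /=; rewrite mulr0 (pihomogMl0 _ hgs).
  rewrite Kmap_cst0 => h; exists 0; split=> //.
  exact/KAll_zero/rpred0.
rewrite (Kmap_dK (f' := pihomog mdeg e)); last first.
  by move=> g s /(allP hg) hgs /=; rewrite -(pihomogMl _ _ hgs).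
move=> h; exists (Kmap (pihomog mdeg e) w); split=> //.
by apply: (@KAll_Kmap _ (fun=> True)); [move=> s _; apply: pihomogP | apply: KAll_true].
Qed.

(** If [z' = d u + y b] modulo [xs], applying [d] gives [y z = d z' = y d b], and [y] cancels: the
    class of [z] is zero once that of [z'] is. *)
Lemma zigzag_back gs xs y p (z : KC S p (size gs)) (z' : KC S p.+1 (size gs)) :
  reg (y :: xs) -> KAll (idl xs) (y *: z - dK gs z') ->
  (exists u, KAll (idl (y :: xs)) (z' - dK gs u)) ->
  exists u, KAll (idl xs) (z - dK gs u).
Proof.
move=> [_ hy] hz [u /KAll_split[b hb]]; exists b.
apply: KAll_nzd hy _; rewrite scalerBr.
have := dK_KAll (idl_ideal xs) hb.
rewrite !linearB linearZ /= dK_dK subr0 => h.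
by have := KAllD (idl_ideal xs) hz h; rewrite addrA subrK.
Qed.

Lemma scale_cross (R : comNzRingType) (M : lmodType R) (a b : R) (z t u : M) :
  a *: t - b *: u = b *: (a *: z - u) - a *: (b *: z - t).
Proof. by rewrite !scalerBr !scalerA [b * a]mulrC opprB [RHS]addrC addrA subrK. Qed.

(** Modulo [xs], [y d w = y y2 z = y2 d z'], so [y w - y2 z'] is a cycle in a degree above the
    length of [xs], where homology vanishes. Hence [y2] kills the class of [z'] once [y] is divided
    out. *)
Lemma zigzag_next gs xs y y2 (z : KC S (size xs) (size gs))
    (z' w : KC S (size xs).+1 (size gs)) :
  reg gs -> reg xs ->
  KAll (idl xs) (y *: z - dK gs z') -> KAll (idl xs) (y2 *: z - dK gs w) ->
  exists v, KAll (idl (y :: xs)) (y2 *: z' - dK gs v).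
Proof.
move=> hg hx hz hw.
have [|v hv] := @koszul_exact_mod _ gs xs (size xs) (y *: w - y2 *: z') hg hx (leqnn _).
  have -> : dK gs (y *: w - y2 *: z') =
      y2 *: (y *: z - dK gs z') - y *: (y2 *: z - dK gs w).
    by rewrite linearB /= [dK gs (y *: w)]linearZ [dK gs (y2 *: z')]linearZ; apply: scale_cross.
  by apply: KAllB => //; apply: KAllZ.
exists (- v).
have -> : y2 *: z' - dK gs (- v) = y *: w - (y *: w - y2 *: z' - dK gs v).
  by rewrite linearN opprK /= -[_ - dK gs v]addrA -opprD subKr.
apply: KAllB => //; first exact: KAll_idl_scale.
by apply: KAll_impl hv => s; apply: idl_cons.
Qed.

Lemma zigzag_cycle gs xs y p (z : KC S p (size gs)) (z' : KC S p.+1 (size gs)) :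
  KAll (idl xs) (y *: z - dK gs z') -> KAll (idl (y :: xs)) (dK gs z').
Proof.
move=> h.
have -> : dK gs z' = y *: z - (y *: z - dK gs z') by rewrite opprB addrC subrK.
apply: KAllB => //; first exact: KAll_idl_scale.
by apply: KAll_impl h => s; apply: idl_cons.
Qed.

Lemma reg_catrev ys xs : reg (catrev ys xs) -> reg xs.
Proof. by elim: ys xs => [|y ys IH] xs //= /IH[]. Qed.

(** Each form of [ys] is moved to [xs], lowering the coefficient degree by one. As [e < size ys], a
    form is left when degree zero is reached; there the lift is zero, and [zigzag_back] returns to
    [z]. *)
Lemma koszul_zigzag_low gs ys xs e (z : KC S (size xs) (size gs)) :
  reg gs -> all (fun g => g \is 2.-homog) gs ->
  reg (catrev ys xs) -> all (fun x => x \is 1.-homog) (ys ++ xs) ->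
  Khom e z -> (forall y, y \in ys -> exists w, KAll (idl xs) (y *: z - dK gs w)) ->
  (e < size ys)%N -> exists u, KAll (idl xs) (z - dK gs u).
Proof.
move=> hg hq; elim: ys xs e z => [|y ys IH] xs e z //= hr /andP[hy hyx] hz hann he.
have hryx := reg_catrev hr; have hrx := hryx.1.
have [w hw] := hann y (mem_head _ _).
have hx : all (fun x => x \is 1.-homog) xs by move: hyx; rewrite all_cat => /andP[].
have [z' [hz' hzz' he0]] := zigzag_lift hq hx hy hz hw.
apply: (zigzag_back hryx hzz').
case: e he hz' he0 {hz} => [|e] he hz' he0.
  by exists 0; rewrite he0 // linear0 subr0; apply: KAll0.
apply: (IH (y :: xs) e) => //.
  by move: hyx; rewrite !all_cat /= hy.
move=> y2 hy2; have [|w2 hw2] := hann y2; first by rewrite inE hy2 orbT.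
exact: zigzag_next hzz' hw2.
Qed.
End Zigzag.

(** * Constant Koszul cycles modulo an ideal *)

Section Adapted.
Variables (K : fieldType) (N : nat).
Local Notation S := {mpoly K[N]}.
Implicit Types (gs xs ys : seq S) (L : S -> Prop).

Fixpoint kspan gs (s : S) : Prop :=
  if gs is g :: gs' then exists c : K, kspan gs' (s - c *: g) else s = 0.

(* [t] of the quadrics lie in [L] and each other one is independent, modulo [L], of those before
   it. Constant Koszul cycles modulo [L] are then supported on the [t] quadrics in [L]; a
   triangular change of the quadrics, which preserves regularity, reaches this form. *)
Fixpoint adapted L gs (t : nat) : Prop :=
  if gs is g :: gs' then
    (exists2 t', t = t'.+1 & adapted L gs' t' /\ L g) \/
    (adapted L gs' t /\ forall (c : K) h, kspan gs' h -> L (h + c *: g) -> c = 0)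
  else t = 0%N.

Definition Kconst p m (z : KC S p m) : Prop := KAll (fun s : S => exists c, s = c%:MP) z.

(** The differential leaving degree zero is zero, so everything in degree zero is a cycle. *)
Definition cycle_mod L gs p (z : KC S p (size gs)) : Prop :=
  match p return KC S p (size gs) -> Prop with
  | 0 => fun=> True
  | p'.+1 => fun z => KAll L (dK gs z)
  end z.

Arguments cycle_mod L gs {p} z : simpl never.

Lemma Kconst0 p m : Kconst (0 : KC S p m).
Proof. by apply: KAll_zero; exists 0; rewrite mpolyC0. Qed.

Lemma Kconst_pair p m (u : KC S p.+1 m) (v : KC S p m) :
  Kconst u -> Kconst v -> @Kconst p.+1 m.+1 (u, v).
Proof. by []. Qed.

Lemma kspan0 gs : kspan gs 0.
Proof. by elim: gs => //= g gs IH; exists 0; rewrite scale0r subr0. Qed.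

Lemma kspanD gs a b : kspan gs a -> kspan gs b -> kspan gs (a + b).
Proof.
elim: gs a b => /= [|g gs IH] a b; first by move=> -> ->; rewrite addr0.
by move=> [c hc] [e he]; exists (c + e); rewrite scalerDl opprD addrACA; apply: IH.
Qed.

Lemma kspanZ gs (c : K) a : kspan gs a -> kspan gs (c *: a).
Proof.
elim: gs a => /= [|g gs IH] a; first by move=> ->; rewrite scaler0.
by move=> [e he]; exists (c * e); rewrite -scalerA -scalerBr; apply: IH.
Qed.

Lemma kspan_cons g gs s : kspan gs s -> kspan (g :: gs) s.
Proof. by move=> h; exists 0; rewrite scale0r subr0. Qed.

Lemma kspan_head g gs (c : K) : kspan (g :: gs) (g * c%:MP).
Proof. by exists c; rewrite mulrC mul_mpolyC subrr; apply: kspan0. Qed.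

Lemma dK_kspan gs p (z : KC S p.+1 (size gs)) : Kconst z -> KAll (kspan gs) (dK gs z).
Proof.
elim: gs p z => [|g gs IH] p z; first by move=> _; apply: KAll_zero.
have [u [v ->]] := KC_cons z.
move=> [hu hv].
have h1 : KAll (kspan (g :: gs)) (dK gs u + g *: v).
  apply: KAll_add; first exact: kspanD.
    by apply: KAll_impl (IH _ _ hu); apply: kspan_cons.
  by apply: KAll_scale hv => _ [c ->]; apply: kspan_head.
case: p {z} u v hu hv h1 => [|p] u v hu hv h1 //.
split=> //; apply: (@KAll_opp _ (kspan gs)); last exact: IH.
by move=> a /(kspanZ (-1)) h; apply: kspan_cons; rewrite -scaleN1r.
Qed.

Lemma Kconst_indep L (Q : S -> Prop) g p m (y v : KC S p m) :
  (forall (c : K) h, Q h -> L (h + c *: g) -> c = 0) ->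
  Kconst v -> KAll Q y -> KAll L (y + g *: v) -> v = 0.
Proof.
move=> hg; elim: p m y v => [|p IHp] m.
  move=> y _ [c ->] hy; rewrite /GRing.scale /= mulrC mul_mpolyC => hL.
  by rewrite (hg c y) // mpolyC0.
elim: m => [|m IHm]; first by move=> y v _ _ _; rewrite [v]KC00.
move=> y v; have [y1 [y2 ->]] := KC_cons y; have [v1 [v2 ->]] := KC_cons v.
move=> [c1 c2] [q1 q2] [l1 l2].
by congr (_, _); [apply: (IHm y1) | apply: (IHp m y2)].
Qed.

Lemma cycle_mod_cons L g gs p (u : KC S p.+1 (size gs)) (v : KC S p (size gs)) :
  ideal L -> @cycle_mod L (g :: gs) p.+1 (u, v) ->
  KAll L (dK gs u + g *: v) /\ cycle_mod L gs v.
Proof.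
move=> hL; case: p u v => [|p] u v; first by [].
move=> [h1 h2]; split=> //.
by have := KAllN hL h2; rewrite opprK.
Qed.

Lemma cycle_mod_pair L g gs p (u : KC S p.+1 (size gs)) (v : KC S p (size gs)) :
  ideal L -> KAll L (dK gs u + g *: v) -> cycle_mod L gs v ->
  @cycle_mod L (g :: gs) p.+1 (u, v).
Proof.
move=> hL; case: p u v => [|p] u v h1 h2 //.
by split=> //; apply: KAllN.
Qed.

Lemma cycle_mod_good L g gs p (u : KC S p.+1 (size gs)) (v : KC S p (size gs)) :
  ideal L -> L g -> @cycle_mod L (g :: gs) p.+1 (u, v) ->
  cycle_mod L gs u /\ cycle_mod L gs v.
Proof.
move=> hL hg /(cycle_mod_cons hL)[h1 h2]; split=> //.
rewrite /cycle_mod; have -> : dK gs u = (dK gs u + g *: v) - g *: v by rewrite addrK.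
apply: KAllB => //; apply: (@KAll_scale _ (fun=> True)); last exact: KAll_true.
by move=> a _; rewrite mulrC; apply: idealM.
Qed.

(** Since [u] is constant, [d u] has coefficients in the [K]-span of [gs]; independence of [g]
    modulo [L] then forces [v = 0]. *)
Lemma cycle_mod_bad L g gs p (u : KC S p.+1 (size gs)) (v : KC S p (size gs)) :
  ideal L -> (forall (c : K) h, kspan gs h -> L (h + c *: g) -> c = 0) ->
  @Kconst p.+1 (size gs).+1 (u, v) -> @cycle_mod L (g :: gs) p.+1 (u, v) ->
  cycle_mod L gs u /\ v = 0.
Proof.
move=> hL hg [hu hv] /(cycle_mod_cons hL)[h1 h2].
have v0 : v = 0 by apply: Kconst_indep hg hv (dK_kspan hu) h1.
by split=> //; rewrite /cycle_mod; move: h1; rewrite v0 scaler0 addr0.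
Qed.

(** Constant cycles of degree [p] form the [p]-th exterior power of a space of dimension [t]. *)
Lemma const_cycle_eq0 L gs t p (z : KC S p (size gs)) :
  ideal L -> adapted L gs t -> (t < p)%N -> Kconst z -> cycle_mod L gs z -> z = 0.
Proof.
move=> hL; elim: gs t p z => [|g gs IH] t [//|p] z.
  by move=> _ _ _ _; apply: KC00.
have [u [v ->]] := KC_cons z.
move=> [[t' -> [ha hg]]|[ha hg]] htp hz.
  case/(cycle_mod_good hL hg) => hu hv; case: hz => cu cv.
  have -> := IH t' p.+1 u ha (ltnW htp) cu hu.
  by have -> := IH t' p v ha htp cv hv.
case/(cycle_mod_bad hL hg hz) => hu ->; case: hz => cu _.
by have -> := IH t p.+1 u ha htp cu hu.
Qed.

(** The top exterior power is a line: at a quadric in [L], the parts [u1] and [u2] vanish, their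
    degree exceeding the number of remaining quadrics in [L]. *)
Lemma const_cycle_dep L gs t (z1 z2 : KC S t (size gs)) :
  ideal L -> adapted L gs t -> Kconst z1 -> Kconst z2 ->
  cycle_mod L gs z1 -> cycle_mod L gs z2 ->
  exists a b : K, (a, b) != (0, 0) /\ a%:MP *: z1 + b%:MP *: z2 = 0.
Proof.
move=> hL.
have base m (y1 y2 : KC S 0 m) : Kconst y1 -> Kconst y2 ->
    exists a b : K, (a, b) != (0, 0) /\ a%:MP *: y1 + b%:MP *: y2 = 0.
  move=> [c1 ->] [c2 ->]; have [-> | h] := eqVneq c1 0.
    exists 1, 0; rewrite xpair_eqE oner_eq0; split=> //.
    by rewrite mpolyC0 scaler0 scale0r addr0.
  exists c2, (- c1); rewrite xpair_eqE oppr_eq0 (negPf h) andbF; split=> //.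
  by rewrite /GRing.scale /= mpolyCN mulNr mulrC subrr.
elim: gs t z1 z2 => [|g gs IH] [|t] z1 z2; try by [|move=> _ ? ? _ _; apply: base].
have [u1 [v1 ->]] := KC_cons z1; have [u2 [v2 ->]] := KC_cons z2.
move=> [[t' [<-] [ha hg]]|[ha hg]] hz1 hz2.
  case/(cycle_mod_good hL hg) => hu1 hv1; case/(cycle_mod_good hL hg) => hu2 hv2.
  case: hz1 hz2 => cu1 cv1 [cu2 cv2].
  have -> : u1 = 0 by apply: const_cycle_eq0 hL ha (ltnSn t) cu1 hu1.
  have -> : u2 = 0 by apply: const_cycle_eq0 hL ha (ltnSn t) cu2 hu2.
  have [a [b [hab e]]] := IH t v1 v2 ha cv1 cv2 hv1 hv2.
  have e0 : a%:MP *: (0 : KC S t.+1 (size gs)) + b%:MP *: 0 = 0 by rewrite !scaler0 addr0.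
  by exists a, b; split=> //; congr (_, _).
case/(cycle_mod_bad hL hg hz1) => hu1 ->; case/(cycle_mod_bad hL hg hz2) => hu2 ->.
case: hz1 hz2 => cu1 _ [cu2 _].
have [a [b [hab e]]] := IH t.+1 u1 u2 ha cu1 cu2 hu1 hu2.
have e0 : a%:MP *: (0 : KC S t (size gs)) + b%:MP *: 0 = 0 by rewrite !scaler0 addr0.
by exists a, b; split=> //; congr (_, _).
Qed.

Lemma const_cycle_exists L gs t p : ideal L -> adapted L gs t -> (p <= t)%N ->
  exists z : KC S p (size gs), [/\ Kconst z, cycle_mod L gs z & z != 0].
Proof.
move=> hL.
have base m : exists z : KC S 0 m, Kconst z /\ z != 0.
  by exists 1; split; [exists 1; rewrite mpolyC1 | apply: oner_neq0].
elim: gs t p => [|g gs IH] t [|p] /=.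
- by move=> _ _; have [z []] := base 0%N; exists z.
- by move=> ->.
- by move=> _ _; have [z []] := base (size gs).+1; exists z.
move=> [[t' -> [ha hg]]|[ha hg]] hp.
  have [v [cv hv nz]] := IH t' p ha hp.
  exists (0, v); split.
  - by apply: Kconst_pair => //; apply: Kconst0.
  - apply: cycle_mod_pair => //; rewrite linear0 add0r.
    apply: (@KAll_scale _ (fun=> True)); last exact: KAll_true.
    by move=> a _; rewrite mulrC; apply: idealM.
  - by apply: contra nz => /eqP[->].
have [u [cu hu nz]] := IH t p.+1 ha hp.
exists (u, 0); split.
- by apply: Kconst_pair => //; apply: Kconst0.
- apply: cycle_mod_pair => //; first by rewrite scaler0 addr0.
  by case: p {u cu hu nz hp} => [|p] //; rewrite /cycle_mod linear0; apply: KAll0.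
- by apply: contra nz => /eqP[->].
Qed.
End Adapted.
Arguments cycle_mod {K N} L gs {p} z : simpl never.

(** * Elements killed by linear forms modulo the quadrics *)

Section Socle.
Variables (K : fieldType) (N : nat).
Local Notation S := {mpoly K[N]}.
Implicit Types (gs xs ys : seq S) (L : S -> Prop).

(** If [g] agrees modulo [L] with a combination [h] of the earlier quadrics, [g - h] replaces it;
    this changes neither the ideal nor multiplication by [g] modulo the earlier quadrics. *)
Lemma reg_adapt L gs : ideal L -> reg gs -> all (fun g => g \is 2.-homog) gs ->
  exists gs' t, [/\ reg gs', all (fun g => g \is 2.-homog) gs', adapted L gs' t &
    forall s, idl gs' s <-> idl gs s].
Proof.
move=> hI; elim: gs => [|g gs IH] /=; first by move=> _ _; exists [::], 0%N.
move=> [hr hg] /andP[hq hqs].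
have [gs' [t [hr' hq' ha e]]] := IH hr hqs.
have kspan_idl h : kspan gs' h -> h \is 2.-homog /\ idl gs' h.
  elim: gs' h hq' {hr' ha e} => [|g' gs' IH'] h /=.
    by move=> _ ->; split; rewrite ?rpred0.
  case/andP=> hg' /IH'{}IH' [c /IH'[h1 h2]]; split.
    by rewrite -(subrK (c *: g') h) rpredD // dhomogZ.
  by exists c%:MP; rewrite mul_mpolyC.
have [[h [hh hL]]|hn] := excluded_middle_informative (exists h, kspan gs' h /\ L (g - h)).
  have [h2 hi] := kspan_idl h hh.
  exists (g - h :: gs'), t.+1; split=> /=.
  - split=> // p hp; apply/e/hg/e.
    have -> : g * p = (g - h) * p + p * h by rewrite mulrBl [p * h]mulrC subrK.
    by apply: idealD => //; apply: idealM.
  - by rewrite rpredB.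
  - by left; exists t.
  - move=> s; split=> [[a /e ha']|[a /e ha']]; exists a.
      have -> : s - a * g = s - a * (g - h) - a * h by rewrite mulrBr opprB addrA addrAC addrK.
      by apply: idealB => //; apply: idealM => //; apply/e.
    have -> : s - a * (g - h) = s - a * g + a * h by rewrite mulrBr opprB addrA addrAC.
    by apply: idealD => //; apply: idealM.
exists (g :: gs'), t; split=> /=.
- by split=> // p /e/hg/e.
- by rewrite hq.
- right; split=> // c h hh hL; apply/eqP; apply/negP => /negP hc; apply: hn.
  exists (- c^-1 *: h); split; first exact: kspanZ.
  have := idealM hI (c^-1)%:MP hL.
  by rewrite mul_mpolyC scalerDr scalerA mulVf // scale1r scaleNr opprK addrC.
- by move=> s; split=> [[a /e ha']|[a /e ha']]; exists a.
Qed.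

(** Otherwise a nonzero constant cycle exists in degree [size xs + 1], where it is a boundary modulo
    [xs]. Boundaries and the ideal of [xs] have no part of degree zero, so the cycle would be
    zero. *)
Lemma adapted_le gs xs t : reg gs -> all (fun g => g \is 2.-homog) gs ->
  reg xs -> all (fun x => x \is 1.-homog) xs -> adapted (idl xs) gs t -> (t <= size xs)%N.
Proof.
move=> hg hq hr hx ha; rewrite leqNgt; apply/negP => ht.
have [z [cz hz nz]] := const_cycle_exists (idl_ideal xs) ha ht.
have [w hw] := koszul_exact_mod hg hr (leqnn _) hz.
move/negP: nz; apply; apply/eqP.
have := KAll_Kmap (L' := fun s => s = 0) (f := pihomog mdeg 0) (fun s => @idl_pihomog0 _ _ 1 xs 0 s hx isT) hw.
move/KAll_eq0; rewrite KmapB (Kmap_dK (f' := fun=> 0)); last first.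
  by move=> g s /(allP hq) hgs /=; rewrite mulr0 (pihomogMl0 _ hgs).
rewrite Kmap_cst0 linear0 subr0 Kmap_id //.
apply: KAll_impl cz => _ [c ->]; apply: pihomog_dE.
by rewrite -[c%:MP]mulr1 mul_mpolyC dhomogZ // dhomog1.
Qed.

Lemma scale_combine (R : comNzRingType) (M : lmodType R) (a b c : R) (z1 z2 u1 u2 : M) :
  a *: (c *: z1 - u1) + b *: (c *: z2 - u2) =
  c *: (a *: z1 + b *: z2) - (a *: u1 + b *: u2).
Proof.
rewrite !scalerBr addrACA -opprD !scalerA [a * c]mulrC [b * c]mulrC.
by rewrite scalerDr !scalerA.
Qed.

(** When [ys] is used up, the coefficients are constant and the Koszul degree is [size xs], at least
    [t] by [adapted_le]. Constant cycles there are dependent if it equals [t] and zero if it exceeds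
    [t]; [zigzag_back] carries the relation back. *)
Lemma koszul_zigzag_dep gs ys xs t (z1 z2 : KC S (size xs) (size gs)) :
  reg gs -> all (fun g => g \is 2.-homog) gs ->
  reg (catrev ys xs) -> all (fun x => x \is 1.-homog) (ys ++ xs) ->
  adapted (idl (catrev ys xs)) gs t ->
  Khom (size ys) z1 -> Khom (size ys) z2 ->
  cycle_mod (idl xs) gs z1 -> cycle_mod (idl xs) gs z2 ->
  (forall y, y \in ys -> exists w, KAll (idl xs) (y *: z1 - dK gs w)) ->
  (forall y, y \in ys -> exists w, KAll (idl xs) (y *: z2 - dK gs w)) ->
  exists a b : K, (a, b) != (0, 0) /\
    exists u, KAll (idl xs) (a%:MP *: z1 + b%:MP *: z2 - dK gs u).
Proof.
move=> hg hq; elim: ys xs z1 z2 => [|y ys IH] xs z1 z2 /= hr hyx ha hz1 hz2 c1 c2 ann1 ann2.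
  have hx : all (fun x => x \is 1.-homog) xs := hyx.
  have cst (z : KC S (size xs) (size gs)) : Khom 0 z -> Kconst z.
    by apply: KAll_impl => s /dhomog0_const.
  have := adapted_le hg hq hr hx ha; rewrite leq_eqVlt => /orP[/eqP e|lt].
    rewrite e in ha.
    have [a [b [hab h]]] := const_cycle_dep (idl_ideal xs) ha (cst _ hz1) (cst _ hz2) c1 c2.
    by exists a, b; split=> //; exists 0; rewrite h linear0 subr0; apply: KAll0.
  have z10 := const_cycle_eq0 (idl_ideal xs) ha lt (cst _ hz1) c1.
  exists 1, 0; split; first by rewrite xpair_eqE oner_eq0.
  exists 0; rewrite z10 mpolyC0 scale0r scaler0 addr0 linear0 subr0; exact: KAll0.
case/andP: hyx => hy hyx.
have hryx := reg_catrev hr; have hrx := hryx.1.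
have hx : all (fun x => x \is 1.-homog) xs by move: hyx; rewrite all_cat => /andP[].
have [w1 hw1] := ann1 y (mem_head _ _); have [w2 hw2] := ann2 y (mem_head _ _).
have [z1' [hz1' h1 _]] := zigzag_lift hq hx hy hz1 hw1.
have [z2' [hz2' h2 _]] := zigzag_lift hq hx hy hz2 hw2.
have [|||||a [b [hab hu]]] := IH (y :: xs) z1' z2' hr _ ha hz1' hz2'.
- by move: hyx; rewrite !all_cat /= hy.
- exact: zigzag_cycle h1.
- exact: zigzag_cycle h2.
- move=> y2 hy2; have [|w hw] := ann1 y2; first by rewrite inE hy2 orbT.
  exact: zigzag_next h1 hw.
- move=> y2 hy2; have [|w hw] := ann2 y2; first by rewrite inE hy2 orbT.
  exact: zigzag_next h2 hw.
exists a, b; split=> //; apply: (zigzag_back hryx _ hu).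
have -> : dK gs (a%:MP *: z1' + b%:MP *: z2') = a%:MP *: dK gs z1' + b%:MP *: dK gs z2'.
  by rewrite linearD /= [dK gs (_ *: z1')]linearZ [dK gs (_ *: z2')]linearZ.
have := KAllD (idl_ideal xs) (KAllZ a%:MP (idl_ideal xs) h1) (KAllZ b%:MP (idl_ideal xs) h2).
by rewrite scale_combine.
Qed.

Lemma socle_low gs ys e (f : S) : reg gs -> all (fun g => g \is 2.-homog) gs ->
  reg (rev ys) -> all (fun x => x \is 1.-homog) ys -> f \is e.-homog -> (e < size ys)%N ->
  (forall y, y \in ys -> idl gs (y * f)) -> idl gs f.
Proof.
move=> hg hq hr hx hf he ann.
have [|y hy|u /= hu] := @koszul_zigzag_low _ _ gs ys [::] e f hg hq hr _ hf _ he.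
- by rewrite cats0.
- have /idl_dK[w hw] := ann y hy.
  by exists w; rewrite /= -hw subrr.
by apply/idl_dK; exists u; apply/eqP; rewrite -subr_eq0; apply/eqP.
Qed.

Lemma socle_dep gs ys (f1 f2 : S) : reg gs -> all (fun g => g \is 2.-homog) gs ->
  reg (rev ys) -> all (fun x => x \is 1.-homog) ys ->
  f1 \is (size ys).-homog -> f2 \is (size ys).-homog ->
  (forall y, y \in ys -> idl gs (y * f1)) -> (forall y, y \in ys -> idl gs (y * f2)) ->
  exists a b : K, (a, b) != (0, 0) /\ idl gs (a *: f1 + b *: f2).
Proof.
move=> hg hq hr hx hf1 hf2 ann1 ann2.
(* The zigzag ends modulo all of [ys], so the quadrics are adapted to that ideal from the start. *)
have [gs' [t [hg' hq' ha e]]] := reg_adapt (idl_ideal (rev ys)) hg hq.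
have [|||a [b [hab [u /= hu]]]] :=
  @koszul_zigzag_dep gs' ys [::] t f1 f2 hg' hq' hr _ ha hf1 hf2 I I.
- by rewrite cats0.
- move=> y hy; have /e/idl_dK[w hw] := ann1 y hy.
  by exists w; rewrite /= -hw subrr.
- move=> y hy; have /e/idl_dK[w hw] := ann2 y hy.
  by exists w; rewrite /= -hw subrr.
exists a, b; split=> //; apply/e/idl_dK; exists u.
by apply/eqP; rewrite -subr_eq0 -!mul_mpolyC; apply/eqP.
Qed.
End Socle.

(** * Independent linear forms are a regular sequence *)

Section LinearForms.
Variables (K : fieldType) (N : nat).
Local Notation S := {mpoly K[N]}.
Implicit Types (vs : seq 'rV[K]_N).

Lemma linform_is_linear : linear (@linform K N).
Proof.
move=> a u v; rewrite /linform scaler_sumr -big_split /=.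
by apply: eq_bigr => i _; rewrite !mxE scalerDl scalerA.
Qed.

HB.instance Definition _ := GRing.isLinear.Build K 'rV[K]_N S _ (@linform K N) linform_is_linear.

Lemma linform_homog (v : 'rV[K]_N) : linform v \is 1.-homog.
Proof. by apply: rpred_sum => i _; rewrite dhomogZ // dhomogX /= mdeg1. Qed.

Lemma linform_inj (v : 'rV[K]_N) : linform v = 0 -> v = 0.
Proof.
move=> h; apply/rowP => i; rewrite mxE.
have := congr1 (meval (fun j => (j == i)%:R)) h.
rewrite meval0 raddf_sum (bigD1 i) //= mevalZ mevalXU eqxx mulr1 big1 ?addr0 // => j hj.
by rewrite mevalZ mevalXU (negPf hj) mulr0.
Qed.

Lemma idl_linform_span vs (v : 'rV[K]_N) :
  v \in <<vs>>%VS -> idl [seq linform u | u <- vs] (linform v).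
Proof.
elim: vs v => [|u vs IH] v /=; first by rewrite span_nil memv0 => /eqP ->; apply: linear0.
rewrite span_cons => /memv_addP[_ /vlineP[a ->] [w hw ->]].
by exists a%:MP; rewrite linearD linearZ /= mul_mpolyC [_ + linform w]addrC addrK; apply: IH.
Qed.

(** A substitution whose kernel is exactly the ideal of the forms of [vs]; it identifies the
    quotient with a subring of [S], hence a domain. *)
Definition proj_away vs (p : S) : S :=
  p \mPo [tuple linform (delta_mx 0 i - projv <<vs>>%VS (delta_mx 0 i)) | i < N].

Lemma proj_away_linform vs (v : 'rV[K]_N) :
  proj_away vs (linform v) = linform (v - projv <<vs>>%VS v).
Proof.
rewrite /proj_away {1}/linform raddf_sum /= {2 3}(row_sum_delta v) linear_sum /=.
rewrite -sumrB linear_sum /=; apply: eq_bigr => i _.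
by rewrite comp_mpolyZ comp_mpolyXU -tnth_nth tnth_mktuple linearZ /= -scalerBr linearZ.
Qed.

Lemma proj_away_idl vs p : idl [seq linform u | u <- vs] (p - proj_away vs p).
Proof.
set L := idl _; have hL : ideal L := idl_ideal _.
have hX i : L ('X_i - proj_away vs 'X_i).
  have -> : 'X_i = linform (delta_mx 0 i) :> S.
    rewrite /linform (bigD1 i) //= mxE !eqxx scale1r big1 ?addr0 // => j hj.
    by rewrite mxE eqxx /= (negPf hj) scale0r.
  by rewrite proj_away_linform -linearB /= opprB addrC subrK; apply/idl_linform_span/memv_proj.
clearbody L.
have h1 : L (1 - proj_away vs 1) by rewrite /proj_away rmorph1 subrr; apply: ideal0.
have hM a b : L (a - proj_away vs a) -> L (b - proj_away vs b) ->
    L (a * b - proj_away vs (a * b)).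
  move=> ha hb; rewrite /proj_away rmorphM /= -!/(proj_away _ _).
  have -> : a * b - proj_away vs a * proj_away vs b =
      a * (b - proj_away vs b) + proj_away vs b * (a - proj_away vs a).
    by rewrite mulrBr mulrBr addrA [_ * a]mulrC subrK [proj_away vs b * _]mulrC.
  by apply: (idealD hL); apply: (idealM hL).
elim/mpolyind: p => [|c m p _ _ IH]; first by rewrite /proj_away raddf0 subr0; apply: ideal0.
rewrite /proj_away raddfD /= opprD addrACA -!/(proj_away _ _).
apply: (idealD hL) IH; rewrite /proj_away comp_mpolyZ -scalerBr -mul_mpolyC.
apply: (idealM hL); rewrite mpolyXE_id -/(proj_away _ _).
elim/big_rec: _ => [|i y _ hy]; first exact: h1.
apply: (hM _ _ _ hy); elim: (m i) => [|k IHk]; first by rewrite expr0.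
by rewrite exprS; apply: (hM _ _ (hX i) IHk).
Qed.

Lemma proj_away_eq0 vs p : idl [seq linform u | u <- vs] p -> proj_away vs p = 0.
Proof.
have h u : u \in vs -> proj_away vs (linform u) = 0.
  by move=> hu; rewrite proj_away_linform projv_id ?subrr ?linear0 // memv_span.
have gen us : {subset us <= vs} -> forall s, idl [seq linform u | u <- us] s ->
    proj_away vs s = 0.
  elim: us => [|u us IH] hsub s /=; first by move=> ->; apply: raddf0.
  move=> [a]; have hsub' : {subset us <= vs} by move=> w hw; apply: hsub; rewrite inE hw orbT.
  move/(IH hsub'); rewrite /proj_away raddfB /= rmorphM /= -!/(proj_away _ _).
  by rewrite (h u) ?mulr0 ?subr0 // hsub // mem_head.
exact: gen.
Qed.

(** The quotient by the earlier forms is a domain, in which a form outside their span is nonzero. *)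
Lemma reg_linforms vs : free vs -> reg [seq linform u | u <- vs].
Proof.
elim: vs => [|v vs IH] //=; rewrite free_cons => /andP[hv /IH hr].
split=> // p /proj_away_eq0; rewrite /proj_away rmorphM /= -!/(proj_away _ _).
move/eqP; rewrite mulf_eq0 => /orP[|/eqP h0].
  rewrite proj_away_linform => /eqP/linform_inj/eqP; rewrite subr_eq0 => /eqP e.
  by case/negP: hv; rewrite e memv_proj.
by have := proj_away_idl vs p; rewrite h0 subr0.
Qed.
End LinearForms.

(** * Translation of the given regular sequence into reversed lists *)

Section RegularSequence.
Variables (K : fieldType) (N n : nat) (q : 'I_n.+1 -> {mpoly K[N]}).

Fixpoint rprefix (j : nat) : seq {mpoly K[N]} :=
  if j is j'.+1 then q (inord j') :: rprefix j' else [::].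

Lemma idl_rprefix j p : (j <= n.+1)%N -> idl (rprefix j) p <-> in_ideal_prefix q j p.
Proof.
elim: j p => [|j IH] p hj /=.
  split=> [->|[c ->]]; first by exists (fun=> 0); rewrite big_pred0.
  by rewrite big_pred0.
have vj : (inord j : 'I_n.+1) = j :> nat by rewrite inordK.
have split_sum (c : 'I_n.+1 -> {mpoly K[N]}) : \sum_(i < n.+1 | (i < j.+1)%N) c i * q i =
    c (inord j) * q (inord j) + \sum_(i < n.+1 | (i < j)%N) c i * q i.
  rewrite (bigD1 (inord j)) /= ?vj ?ltnSn //; congr (_ + _); apply: eq_bigl => i.
  by rewrite -(inj_eq val_inj) /= vj ltnS [in RHS]ltn_neqAle andbC.
split=> [[a /(IH _ (ltnW hj))[c hc]]|[c ->]].
  exists (fun i => if i == inord j then a else c i).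
  rewrite split_sum eqxx -(subrK (a * q (inord j)) p) hc addrC; congr (_ + _).
  apply: eq_bigr => i hi; case: eqP => // e.
  by move: hi; rewrite e vj ltnn.
exists (c (inord j)); apply/(IH _ (ltnW hj)); exists c.
by rewrite split_sum addrC addKr.
Qed.

Lemma reg_rprefix j : regular_sequence q -> (j <= n.+1)%N -> reg (rprefix j).
Proof.
move=> [hq _]; elim: j => [|j IH] //= hj.
have hj' := ltnW hj; split; first exact: IH.
move=> p /(idl_rprefix _ hj') h; apply/(idl_rprefix _ hj').
by have := hq (inord j) p; rewrite inordK //; apply.
Qed.

Lemma all_rprefix (P : pred {mpoly K[N]}) j : (forall i, P (q i)) -> all P (rprefix j).
Proof. by move=> h; elim: j => //= j ->; rewrite h. Qed.
End RegularSequence.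

(** * Generic points for functions polynomial along lines *)

Section LinePolynomials.
Variables (K : closedFieldType) (V : lmodType K).

Definition polynomial_on_lines (h : V -> K) : Prop :=
  forall u v, exists p : {poly K}, forall s, h (u + s *: v) = p.[s].

Lemma polynomial_on_linesM h1 h2 : polynomial_on_lines h1 -> polynomial_on_lines h2 ->
  polynomial_on_lines (fun c => h1 c * h2 c).
Proof.
move=> H1 H2 u v; have [p hp] := H1 u v; have [r hr] := H2 u v.
by exists (p * r) => s; rewrite hp hr hornerM.
Qed.

(** Along the line through [a] and [b] both functions are nonzero polynomials, and their product has
    a nonroot over an algebraically closed field. *)
Lemma common_nonzero h1 h2 a b : polynomial_on_lines h1 -> polynomial_on_lines h2 ->
  h1 a != 0 -> h2 b != 0 -> exists c, h1 c * h2 c != 0.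
Proof.
move=> H1 H2 ha hb; have [p hp] := H1 a (b - a); have [r hr] := H2 a (b - a).
have hpr : p * r != 0.
  rewrite mulf_neq0 //.
    by apply: contra ha => /eqP p0; have := hp 0; rewrite p0 horner0 scale0r addr0 => ->.
  apply: contra hb => /eqP r0; have := hr 1.
  by rewrite r0 horner0 scale1r addrC subrK => ->.
have [s hs] := closed_nonrootP _ hpr.
by exists (a + s *: (b - a)); rewrite hp hr -hornerM -rootE.
Qed.
End LinePolynomials.

(** * The form describing [k]-th powers, and a basis made of its zeros *)

Section PowerForm.
Variables (K : closedFieldType) (hchar : [pchar K] =i pred0) (N k : nat).
Local Notation S := {mpoly K[N]}.
Variables (lam : {linear 'rV[K]_k -> S}) (I : S -> Prop).
Hypothesis hI : ideal I.
Hypothesis lam_homog : forall c, lam c \is 1.-homog.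
Hypothesis lam_notin : forall c, I (lam c) -> c = 0.
Hypothesis I1 : ~ I 1.
Hypothesis socle_lt : forall e f, f \is e.-homog -> (e < k)%N ->
  (forall c, I (lam c * f)) -> I f.
Hypothesis socle_eq : forall f1 f2, f1 \is k.-homog -> f2 \is k.-homog ->
  (forall c, I (lam c * f1)) -> (forall c, I (lam c * f2)) ->
  exists a b : K, (a, b) != (0, 0) /\ I (a *: f1 + b *: f2).
Hypothesis pow_in : forall c, I (lam c ^+ k.+1).

Implicit Types (f g : S) (c : 'rV[K]_k) (cs : seq 'rV[K]_k).

Lemma natr_neq0 m : (0 < m)%N -> m%:R != 0 :> K.
Proof. by move=> hm; rewrite (pcharf0P K).1 // -lt0n. Qed.

Lemma in_scale (a : K) f : I f -> I (a *: f).
Proof. by move=> hf; rewrite -mul_mpolyC; apply: idealM. Qed.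

Lemma in_scaleV (a : K) f : a != 0 -> I (a *: f) -> I f.
Proof. by move=> ha /(in_scale a^-1); rewrite scalerA mulVf // scale1r. Qed.

Lemma in_sum (T : finType) (P : pred T) (F : T -> S) :
  (forall i, P i -> I (F i)) -> I (\sum_(i | P i) F i).
Proof. by move=> h; apply: big_ind => //; [apply: ideal0 | apply: idealD]. Qed.

(* [F(2t) - 2^m F(t)] has no term of degree [m]. *)
Lemma coef_in m (F : nat -> S) :
  (forall t : K, I (\sum_(i < m) t ^+ i *: F i)) -> forall i, (i < m)%N -> I (F i).
Proof.
elim: m F => [|m IH] F h i //.
have low j : (j < m)%N -> I (F j).
  move=> hj; have hne : (2%:R ^+ j - 2%:R ^+ m : K) != 0.
    have hlt : (2 ^ j < 2 ^ m)%N by rewrite ltn_exp2l.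
    rewrite -!natrX -opprB oppr_eq0 -(natrB _ (ltnW hlt)).
    by apply: natr_neq0; rewrite subn_gt0.
  apply: (in_scaleV hne).
  apply: (IH (fun j => (2%:R ^+ j - 2%:R ^+ m) *: F j)) => // t.
  have := idealB hI (h (2%:R * t)) (in_scale (2%:R ^+ m) (h t)).
  rewrite !big_ord_recr /= scalerDr opprD addrACA exprMn scalerA subrr addr0.
  rewrite scaler_sumr -sumrB; congr I; apply: eq_bigr => l _.
  by rewrite exprMn !scalerA -scalerBl mulrBr [t ^+ l * _]mulrC [t ^+ l * _]mulrC.
rewrite ltnS leq_eqVlt => /orP[/eqP ->|]; last exact: low.
have := h 1; rewrite big_ord_recr /= expr1n scale1r => h1.
rewrite -[F m](addKr (\sum_(l < m) 1 ^+ l *: F l)) addrC.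
by apply: idealB => //; apply: in_sum => l _; rewrite expr1n scale1r; apply: low.
Qed.

Definition prods cs : S := \prod_(c <- cs) lam c.

Lemma prods_cons c cs : prods (c :: cs) = lam c * prods cs.
Proof. by rewrite /prods big_cons. Qed.

Lemma prods_cat cs1 cs2 : prods (cs1 ++ cs2) = prods cs1 * prods cs2.
Proof. by rewrite /prods big_cat. Qed.

Lemma prods_nseq m c : prods (nseq m c) = lam c ^+ m.
Proof. by rewrite /prods big_nseq -Monoid.iteropE. Qed.

Lemma prods_homog cs : prods cs \is (size cs).-homog.
Proof.
elim: cs => [|c cs IH]; first by rewrite /prods big_nil dhomog1.
by rewrite prods_cons; apply: (dhomogM (lam_homog c) IH).
Qed.

Lemma prods_homog_size m cs : size cs = m -> prods cs \is m.-homog.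
Proof. by move=> <-; apply: prods_homog. Qed.

Lemma line_expansion g u v m (s : K) :
  g * lam (u + s *: v) ^+ m =
  \sum_(i < m.+1) s ^+ i *: ((g * lam u ^+ (m - i) * lam v ^+ i) *+ 'C(m, i)).
Proof.
rewrite linearD linearZ /= exprDn mulr_sumr; apply: eq_bigr => i _.
by rewrite exprZn mulrnAr -scalerMnr -!scalerAr mulrA.
Qed.

(** In [g * lam (u + t c) ^+ m.+1] the coefficient of [t] is [(m + 1) g (lam u)^m lam c]. It lies in
    [I], [m + 1] is invertible, and induction applies to [g * lam c]. *)
Lemma polarization m g : (forall c, I (g * lam c ^+ m)) ->
  forall cs, size cs = m -> I (g * prods cs).
Proof.
elim: m g => [|m IH] g h [|c cs] //=.
  by move=> _; have := h 0; rewrite /prods big_nil expr0.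
move=> [hs]; rewrite prods_cons mulrA; apply: IH => // u.
have := @coef_in m.+2 (fun i => (g * lam u ^+ (m.+1 - i) * lam c ^+ i) *+ 'C(m.+1, i)).
move=> /(_ _ 1%N isT) hc.
have {hc} := hc (fun t => eq_ind _ I (h (u + t *: c)) _ (line_expansion g u c m.+1 t)).
rewrite subn1 expr1 bin1 -scaler_nat => /(in_scaleV (natr_neq0 (ltn0Sn m))).
by rewrite mulrAC.
Qed.

(** With one factor fewer, the product has degree below [k] and is killed by every form, so it is in
    [I]; the factors are thus removed one by one. *)
Lemma descend e j g : g \is e.-homog -> (e + j <= k)%N ->
  (forall cs, size cs = j -> I (g * prods cs)) -> I g.
Proof.
move=> hg; elim: j => [|j IH] hj h.
  by have := h [::] erefl; rewrite /prods big_nil mulr1.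
rewrite addnS in hj; apply: IH (ltnW hj) _ => cs hs.
apply: (@socle_lt (e + j)) => // [|c]; first by rewrite dhomogM // -hs prods_homog.
by rewrite mulrCA -prods_cons; apply: h; rewrite /= hs.
Qed.

Lemma prods_socle cs c : size cs = k -> I (lam c * prods cs).
Proof.
move=> hs; rewrite -prods_cons -[prods _]mul1r; apply: (@polarization k.+1).
  by move=> u; rewrite mul1r.
by rewrite /= hs.
Qed.

Lemma top_product_exists : exists cs, size cs = k /\ ~ I (prods cs).
Proof.
have [//|hn] := excluded_middle_informative (exists cs, size cs = k /\ ~ I (prods cs)).
case: I1; apply: (@descend 0 k); rewrite ?dhomog1 ?add0n // => cs hs; rewrite mul1r.
have [//|hc] := excluded_middle_informative (I (prods cs)).
by case: hn; exists cs.
Qed.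

Lemma combination_in u v cs : size cs = k.-1 -> (0 < k)%N ->
  exists a b : K, (a, b) != (0, 0) /\ I (prods ((a *: u + b *: v) :: cs)).
Proof.
move=> hs hk.
have hsz w : size (w :: cs) = k by rewrite /= hs prednK.
have [||||a [b [hab h]]] := @socle_eq (prods (u :: cs)) (prods (v :: cs)).
- exact: prods_homog_size.
- exact: prods_homog_size.
- by move=> c; apply: prods_socle.
- by move=> c; apply: prods_socle.
exists a, b; split=> //.
by rewrite prods_cons linearD !linearZ /= mulrDl -!scalerAl -!prods_cons.
Qed.

(** By [socle_eq] all products of [k] forms are multiples, modulo [I], of one product [w] outside
    [I]; [phi] is the coordinate along [w]. *)
Lemma top_coordinate : exists (w : S) (phi : seq 'rV[K]_k -> K), ~ I w /\
  forall cs, size cs = k -> I (prods cs - phi cs *: w).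
Proof.
have [ws [hws hw]] := top_product_exists; exists (prods ws).
have ex cs : exists a : K, size cs = k -> I (prods cs - a *: prods ws).
  have [hs|hs] := eqVneq (size cs) k; last by exists 0 => /eqP; rewrite (negPf hs).
  have [||||a [b [hab h]]] := @socle_eq (prods cs) (prods ws).
  - exact: prods_homog_size.
  - exact: prods_homog_size.
  - by move=> c; apply: prods_socle.
  - by move=> c; apply: prods_socle.
  have ha : a != 0.
    apply/negP => /eqP a0; apply: hw; move: hab h; rewrite a0 scale0r add0r xpair_eqE eqxx /=.
    by move=> hb /(in_scaleV hb).
  exists (- (b / a)) => _; apply: (in_scaleV ha).
  by rewrite scaleNr opprK scalerDr scalerA mulrCA divff // mulr1.
pose sig cs := constructive_indefinite_description _ (ex cs).
by exists (fun cs => sval (sig cs)); split=> // cs; apply: (svalP (sig cs)).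
Qed.

Section Coordinate.
Variables (w : S) (phi : seq 'rV[K]_k -> K).
Hypothesis hw : ~ I w.
Hypothesis hphi : forall cs, size cs = k -> I (prods cs - phi cs *: w).

Lemma phi_unique cs (a : K) : size cs = k -> I (prods cs - a *: w) -> phi cs = a.
Proof.
move=> hs h; apply/eqP; rewrite -subr_eq0; apply/negP => /negP hne; apply: hw.
apply: (in_scaleV hne).
have := idealB hI h (hphi hs).
by rewrite opprB addrC addrA subrK -scalerBl.
Qed.

Lemma phi_eq0 cs : size cs = k -> (I (prods cs) <-> phi cs = 0).
Proof.
move=> hs; split=> [h|h]; first by apply: phi_unique; rewrite ?scale0r ?subr0.
by have := hphi hs; rewrite h scale0r subr0.
Qed.

Lemma phi_line cs r u v (s : K) : (size cs + r)%N = k ->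
  phi (cs ++ nseq r (u + s *: v)) =
  \sum_(i < r.+1) s ^+ i * (phi (cs ++ nseq (r - i) u ++ nseq i v) *+ 'C(r, i)).
Proof.
move=> hs; apply: phi_unique; first by rewrite size_cat size_nseq.
rewrite prods_cat prods_nseq line_expansion scaler_suml -sumrB.
apply: in_sum => i _; rewrite -scalerA -scalerBr; apply: in_scale.
rewrite -scalerMnl -mulrnBl -scaler_nat; apply: in_scale.
rewrite -mulrA -!prods_nseq -!prods_cat; apply: hphi.
by rewrite !size_cat !size_nseq subnK // -ltnS.
Qed.

Lemma phi_line_poly cs r : (size cs + r)%N = k ->
  polynomial_on_lines (fun c => phi (cs ++ nseq r c)).
Proof.
move=> hs u v.
exists (\poly_(i < r.+1) (phi (cs ++ nseq (r - i) u ++ nseq i v) *+ 'C(r, i))) => s.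
by rewrite phi_line // horner_poly; apply: eq_bigr => i _; rewrite mulrC.
Qed.

(** The diagonal of the multilinear [phi] in coordinates; summing over all maps [t] rather than over
    monomials avoids multinomial coefficients. *)
Definition power_form : {mpoly K[k]} :=
  \sum_(t : {ffun 'I_k -> 'I_k})
    phi [seq delta_mx 0 (t j) | j <- enum 'I_k] *: \prod_(j < k) 'X_(t j).

Lemma power_form_homog : power_form \is k.-homog.
Proof.
apply: rpred_sum => t _; apply: dhomogZ.
have h (r : seq 'I_k) : (\prod_(j <- r) 'X_(t j) : {mpoly K[k]}) \is (size r).-homog.
  elim: r => [|j r IH]; first by rewrite big_nil dhomog1.
  by rewrite big_cons; apply: (@dhomogM _ _ _ 1) => //; rewrite dhomogX /= mdeg1.
by have := h (index_enum 'I_k); rewrite -[index_enum _]enumT /= size_enum_ord.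
Qed.

Lemma power_formE c : phi (nseq k c) = power_form.@[fun i => c 0 i].
Proof.
apply: phi_unique; first by rewrite size_nseq.
have -> : prods (nseq k c) = \sum_(t : {ffun 'I_k -> 'I_k})
    (\prod_(j < k) c 0 (t j)) *: prods [seq delta_mx 0 (t j) | j <- enum 'I_k].
  rewrite prods_nseq {1}(row_sum_delta c) linear_sum /=.
  have -> (x : S) : x ^+ k = \prod_(j < k) x by rewrite prodr_const card_ord.
  rewrite bigA_distr_bigA /=.
  apply: eq_bigr => t _; rewrite /prods big_map big_enum /= -scaler_prod.
  by apply: eq_bigr => j _; rewrite linearZ.
rewrite /power_form raddf_sum /= scaler_suml -sumrB; apply: in_sum => t _.
rewrite mevalZ rmorph_prod /= mulrC -scalerA.
under [X in _ - X *: _]eq_bigr => j _ do rewrite mevalXU.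
rewrite -scalerBr; apply: in_scale; apply: hphi.
by rewrite size_map size_enum_ord.
Qed.

(** Otherwise all [k]-th powers would be in [I] and, by polarization, all products of [k] forms. *)
Lemma power_form_neq0 : power_form != 0.
Proof.
apply/negP => /eqP F0; have [cs [hs hcs]] := top_product_exists.
apply: hcs; rewrite -[prods _]mul1r; apply: (polarization _ hs) => c.
rewrite mul1r -prods_nseq; apply/phi_eq0; rewrite ?size_nseq //.
by rewrite power_formE F0 meval0.
Qed.

(* [t] is found on a line [v + s y0]: there [phi (nseq k _)] is a nonconstant polynomial in [s],
   while the conditions [t \notin U] and [prods (t :: cs)] outside [I] do not depend on [s]. *)
Lemma null_point (U : {vspace 'rV[K]_k}) y0 y1 cs :
  (0 < k)%N -> U != fullv -> y0 \in U -> y0 != 0 -> size cs = k.-1 ->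
  I (prods (y0 :: cs)) -> ~ I (prods (y1 :: cs)) ->
  exists t, [/\ t \notin U, phi (nseq k t) = 0 & ~ I (prods (t :: cs))].
Proof.
move=> hk hU hy0 ny0 hs h0 h1.
have [a ha] : exists a, a \notin U.
  have [//|hn] := excluded_middle_informative (exists a, a \notin U).
  case/eqP: hU; apply/vspaceP => a; rewrite memvf; apply/negPn/negP => ha.
  by apply: hn; exists a.
(* This coordinate of the component off [U] is a linear function vanishing on [U]; its nonvanishing
   keeps a point outside [U]. *)
have [i hi] : exists i, (a - projv U a) 0 i != 0.
  have : a - projv U a != 0.
    by apply: contra ha; rewrite subr_eq0 => /eqP ->; apply: memv_proj.
  by case/rV0Pn => i hi; exists i.
pose f1 (c : 'rV[K]_k) : K := (c - projv U c) 0 i.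
have f1P : polynomial_on_lines f1.
  move=> u v; exists ((f1 u)%:P + f1 v *: 'X) => s.
  rewrite hornerE hornerC hornerZ hornerX /f1 linearD linearZ !mxE.
  by rewrite opprD addrACA -mulrBr [_ * s]mulrC.
have szcs c : (size cs + 1)%N = k by rewrite hs addn1 prednK.
have f2P := phi_line_poly (szcs 0).
have perm c : prods (cs ++ nseq 1 c) = prods (c :: cs).
  by rewrite prods_cat prods_nseq prods_cons expr1 mulrC.
have szc c : size (cs ++ nseq 1 c) = k by rewrite size_cat size_nseq szcs.
have f2y1 : phi (cs ++ nseq 1 y1) != 0.
  by apply/eqP => /(phi_eq0 (szc y1)); rewrite perm.
have sz3 : (size [:: y0] + k.-1)%N = k by rewrite /= add1n prednK.
have f3P := phi_line_poly sz3.
(* Otherwise polarization and [descend] would put [lam y0] in [I], forcing [y0 = 0]. *)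
have [v3 hv3] : exists c, phi ([:: y0] ++ nseq k.-1 c) != 0.
  have [//|hn] := excluded_middle_informative (exists c, phi ([:: y0] ++ nseq k.-1 c) != 0).
  case/eqP: ny0; apply: lam_notin; apply: (@descend 1 k.-1) => //.
    by rewrite add1n prednK.
  move=> ds; apply: polarization => c.
  have -> : lam y0 * lam c ^+ k.-1 = prods ([:: y0] ++ nseq k.-1 c).
    by rewrite prods_cat prods_nseq prods_cons /prods big_nil mulr1.
  apply/phi_eq0; first by rewrite size_cat size_nseq.
  by apply/eqP/negPn/negP => h; apply: hn; exists c.
have [b hb] := common_nonzero f1P f2P hi f2y1.
have [v] := common_nonzero (polynomial_on_linesM f1P f2P) f3P hb hv3.
rewrite !mulf_eq0 !negb_or => /andP[/andP[v1 v2] v3'].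
pose p := \poly_(i < k.+1) (phi (nseq (k - i) v ++ nseq i y0) *+ 'C(k, i)).
have hp s : phi (nseq k (v + s *: y0)) = p.[s].
  rewrite -[nseq _ _]cat0s phi_line // horner_poly.
  by apply: eq_bigr => j _; rewrite mulrC.
(* The coefficient of [s] is [k] times [phi] of [k - 1] copies of [v] and one [y0], nonzero by the
   choice of [v]. *)
have hp1 : size p != 1%N.
  apply/negP => /eqP sz; have := leqnn (size p); rewrite {2}sz => /(nth_default 0) /=.
  rewrite coef_poly ltnS hk bin1 => /eqP; rewrite -mulr_natr mulf_eq0 (negPf (natr_neq0 hk)) orbF.
  move=> /eqP/phi_eq0 e; case/eqP: v3'; apply/phi_eq0.
    by rewrite size_cat size_nseq.
  have := e _; rewrite !prods_cat mulrC subn1; apply.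
  by rewrite size_cat !size_nseq addn1 prednK.
have /closed_rootP[s /rootP hs0] := hp1.
exists (v + s *: y0); split; last 2 first.
- by rewrite hp.
- rewrite prods_cons linearD linearZ /= mulrDl -scalerAl -!prods_cons => ht.
  case/eqP: v2; apply/phi_eq0; rewrite ?perm //.
  by have := idealB hI ht (in_scale s h0); rewrite addrK.
apply/negP => ht; have vU : v \in U by rewrite -(addrK (s *: y0) v) rpredB // memvZ.
by move: v1; rewrite /f1 projv_id // subrr mxE eqxx.
Qed.

Lemma free2_comb (V : vectType K) (u v : V) (a b : K) (X : seq V) :
  free [:: u, v & X] -> (a, b) != (0, 0) -> a *: u + b *: v != 0.
Proof.
rewrite !free_cons => /andP[hu /andP[hv _]]; apply: contraNN => /eqP h.
have [a0|na] := eqVneq a 0.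
  move: h; rewrite a0 scale0r add0r xpair_eqE eqxx => /eqP; rewrite scaler_eq0 => /orP[//|/eqP v0].
  by case/negP: hv; rewrite v0 mem0v.
case/negP: hu; rewrite span_cons.
have -> : u = (- (a^-1 * b)) *: v.
  have : a^-1 *: (a *: u + b *: v) = 0 by rewrite h scaler0.
  rewrite scalerDr !scalerA mulVf // scale1r => /eqP; rewrite addr_eq0 => /eqP ->.
  by rewrite scaleNr.
by apply: rpredZ; apply: (subvP (addvSl _ _)); apply: memv_line.
Qed.

Lemma span_proper (X : seq 'rV[K]_k) : (size X < k)%N -> <<X>>%VS != fullv.
Proof.
move=> hX; apply/negP => /eqP e; have := dim_span X; rewrite e dimvf /dim /= mul1n.
by rewrite leqNgt hX.
Qed.

(** [null_point] needs a nonzero [y0] in [U] killing the product of [cs]. With fewer than [k - 1]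
    points in [xs], any such [y0] can be adjoined to their span. With [k - 1] points the span is a
    hyperplane, so [y0] is sought inside it, using [cs = xs]. *)
Lemma null_point_step xs cs y : (2 <= k)%N -> (size xs < k)%N ->
  (size xs = k.-1 -> cs = xs) -> free xs -> (forall x, x \in xs -> phi (nseq k x) = 0) ->
  size cs = k.-1 -> ~ I (prods (y :: cs)) ->
  exists t, [/\ t \notin <<xs>>%VS, phi (nseq k t) = 0 & ~ I (prods (t :: cs))].
Proof.
move=> hk hxs hcs hfree hnull scs hy.
have hk0 : (0 < k)%N := ltnW hk.
have [hlt|hge] := ltnP (size xs).+1 k.
  have hfree2 : free [:: delta_mx 0 (Ordinal hk0); delta_mx 0 (Ordinal hk) : 'rV[K]_k].
    rewrite free_cons span_seq1 seq1_free; apply/andP; split.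
      apply/negP => /vlineP[a /rowP/(_ (Ordinal hk0))/eqP].
      by rewrite !mxE !eqxx /= mulr0 oner_eq0.
    apply/negP => /eqP/rowP/(_ (Ordinal hk))/eqP.
    by rewrite !mxE !eqxx oner_eq0.
  have [a [b [hab h0]]] := combination_in (delta_mx 0 (Ordinal hk0)) (delta_mx 0 (Ordinal hk))
    scs hk0.
  set y0 := _ + _ in h0; have ny0 : y0 != 0 := free2_comb hfree2 hab.
  have [|t [ht1 ht2 ht3]] := null_point hk0 (@span_proper (y0 :: xs) hlt) _ ny0 scs h0 hy.
    by rewrite memv_span // mem_head.
  exists t; split=> //; apply: contra ht1; apply: subvP; rewrite span_cons; exact: addvSr.
have sxs : size xs = k.-1 by apply/eqP; rewrite eqn_leq -ltnS prednK // hxs /= -ltnS prednK.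
have {hcs}e := hcs sxs; rewrite e in scs hy *.
have [y0 [hy0 ny0 h0]] : exists y0, [/\ y0 \in <<xs>>%VS, y0 != 0 & I (prods (y0 :: xs))].
  case: xs hfree hnull sxs {hxs hge e scs hy} => [|x1 [|x2 xs]] hfree hnull sxs.
  - by exfalso; move: hk; rewrite -(prednK hk0) -sxs.
  (* For [k = 2] the single point serves as [y0], since its square is in [I]. *)
  - exists x1; split; first by rewrite memv_span ?mem_head.
      by move: hfree; rewrite seq1_free.
    have k2 : k = 2 by rewrite -(prednK hk0) -sxs.
    have e2 : nseq k x1 = [:: x1; x1] by apply: (congr1 (nseq ^~ x1) k2).
    apply/phi_eq0; first by rewrite /= k2.
    by rewrite -e2; apply: hnull; rewrite mem_head.
  - have [a [b [hab h0]]] := combination_in x1 x2 sxs hk0.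
    exists (a *: x1 + b *: x2); split=> //; last exact: free2_comb hfree hab.
    by apply: rpredD; apply: rpredZ; apply: memv_span; rewrite !inE eqxx ?orbT.
exact: (null_point hk0 (span_proper hxs) hy0 ny0 scs h0 hy).
Qed.

Lemma null_basis : (2 <= k)%N -> exists xs,
  [/\ size xs = k, free xs, forall x, x \in xs -> phi (nseq k x) = 0 & ~ I (prods xs)].
Proof.
move=> hk; have hk0 : (0 < k)%N := ltnW hk.
(* [xs] holds the null points found so far, [ys] the factors of the initial product still to be
   replaced. *)
suff gen j : (j <= k)%N -> exists xs ys, [/\ size xs = j, size ys = (k - j)%N, free xs,
    forall x, x \in xs -> phi (nseq k x) = 0 & ~ I (prods (xs ++ ys))].
  have [xs [ys [hs]]] := gen k (leqnn k).
  by rewrite subnn => /size0nil ->; rewrite cats0 => h1 h2 h3; exists xs.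
elim: j => [|j IH] hj.
  have [cs [hs hcs]] := top_product_exists.
  by exists [::], cs; rewrite subn0; split=> //; rewrite nil_free.
have [xs [[|y ys] [hxs hys hfree hnull hn]]] := IH (ltnW hj).
  by move: hj; rewrite -subn_gt0 -hys.
have {}hys : size ys = (k - j.+1)%N by rewrite subnS -hys.
have scs : size (xs ++ ys) = k.-1.
  by rewrite size_cat hxs hys subnS -subn1 addnBA ?subn_gt0 // subnKC ?subn1 // ltnW.
have perm t : prods (t :: xs ++ ys) = prods (xs ++ t :: ys).
  by rewrite prods_cons !prods_cat prods_cons mulrCA.
have [|||t [ht1 ht2 ht3]] := @null_point_step xs (xs ++ ys) y hk _ _ hfree hnull scs.
- by rewrite hxs.
- move=> hk1; have ys0 : size ys = 0%N by rewrite hys -hxs hk1 prednK // subnn.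
  by rewrite (size0nil ys0) cats0.
- by rewrite perm.
exists (t :: xs), ys; split=> //=.
- by rewrite hxs.
- by rewrite free_cons ht1.
- by move=> x; rewrite inE => /orP[/eqP ->|/hnull].
Qed.
End Coordinate.
End PowerForm.

(** * Free families and matrices of full row rank *)

Section RowSpace.
Variables (K : fieldType) (k N : nat).

Lemma free_rows (B : 'M[K]_(k, N)) :
  row_free B -> free [tuple row i B | i < k].
Proof.
move=> hB; apply/freeP => a ha i.
have h : (\row_j a j) *m B = 0 *m B.
  rewrite mul0mx mulmx_sum_row -{}[RHS]ha; apply: eq_bigr => j _.
  by rewrite mxE -tnth_nth tnth_mktuple.
by have /rowP/(_ i) := row_free_inj hB h; rewrite !mxE.
Qed.

Lemma row_free_seq (xs : seq 'rV[K]_N) :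
  size xs = k -> free xs -> row_free (\matrix_(i < k) xs`_i).
Proof.
move=> hs; have {hs} hs : size xs == k by apply/eqP.
move=> /(@freeP _ _ _ (Tuple hs)) hfree; apply: inj_row_free => v.
rewrite mulmx_sum_row => hv; apply/rowP => i; rewrite mxE; apply: hfree.
by rewrite -[RHS]hv; apply: eq_bigr => j _; rewrite rowK.
Qed.
End RowSpace.

(** * The hypersurface and the null basis in the space spanned by the rows of [B] *)

Theorem mainTheorem8
  (K : closedFieldType) (hchar : [pchar K] =i pred0)
  (n : nat) (q : 'I_n.+1 -> {mpoly K[n.+1]})
  (hquad : forall i, q i \is 2.-homog)
  (hreg : regular_sequence q)
  (k : nat) (hk : (2 <= k)%N)
  (B : 'M[K]_(k, n.+1)) (hB : row_free B)
  (hpi : forall c : 'rV[K]_k, c != 0 -> in_Nk q k.+1 (c *m B)) :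
  (exists F : {mpoly K[k]},
      [/\ F != 0, F \is k.-homog &
          forall c : 'rV[K]_k, c != 0 ->
            (in_Nk q k (c *m B) <-> F.@[fun i => c 0 i] = 0)])
  /\
  (exists X : 'M[K]_(k, n.+1),
      [/\ row_free X,
          forall i : 'I_k, (row i X <= B)%MS /\ in_Nk q k (row i X) &
          ~ in_ideal q (\prod_(i < k) linform (row i X))]).
Proof.
pose gs := rprefix q n.+1.
have gsE p : idl gs p <-> in_ideal q p by apply: idl_rprefix.
have hg : reg gs by apply: reg_rprefix.
have hq : all (fun g => g \is 2.-homog) gs by apply: all_rprefix.
pose lam : {linear 'rV[K]_k -> {mpoly K[n.+1]}} := (@linform K n.+1) \o mulmxr B.
have lamE c : lam c = linform (c *m B) by [].
have hlam c : lam c \is 1.-homog by apply: linform_homog.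
have injB (c : 'rV[K]_k) : c *m B = 0 -> c = 0.
  by move=> h; apply: (row_free_inj hB); rewrite h mul0mx.
(* An ideal generated by quadrics contains no nonzero linear form, and [B] is injective on
   coordinates. *)
have hnotin c : idl gs (lam c) -> c = 0.
  move=> /(idl_pihomog0 hq (isT : 1 < 2)%N); rewrite (pihomog_dE (hlam c)).
  by move/linform_inj/injB.
have h1 : ~ idl gs 1 by move/gsE; apply: hreg.2.
pose ys := [seq linform v | v <- [tuple row i B | i < k]].
have sys : size ys = k by rewrite size_map size_tuple.
have hys : reg (rev ys).
  rewrite -map_rev; apply: reg_linforms.
  by rewrite (@perm_free _ _ _ [tuple row i B | i < k]) ?free_rows // perm_rev.
have lys : all (fun x => x \is 1.-homog) ys.
  by apply/allP => _ /mapP[v _ ->]; apply: linform_homog.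
have ysE f y : (forall c, idl gs (lam c * f)) -> y \in ys -> idl gs (y * f).
  by move=> h /mapP[_ /mapP[i _ ->] ->]; rewrite rowE -lamE.
have hlt e f : f \is e.-homog -> (e < k)%N -> (forall c, idl gs (lam c * f)) -> idl gs f.
  move=> hf he h; have {}he : (e < size ys)%N by rewrite sys.
  exact: (socle_low hg hq hys lys hf he (fun y => @ysE f y h)).
have heq f1 f2 : f1 \is k.-homog -> f2 \is k.-homog ->
    (forall c, idl gs (lam c * f1)) -> (forall c, idl gs (lam c * f2)) ->
    exists a b : K, (a, b) != (0, 0) /\ idl gs (a *: f1 + b *: f2).
  move=> hf1 hf2 a1 a2; apply: (socle_dep hg hq hys lys); rewrite ?sys //.
    by move=> y; apply: ysE.
  by move=> y; apply: ysE.
have hpow c : idl gs (lam c ^+ k.+1).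
  (* The zero vector is not a projective point, so [hpi] does not cover it. *)
  have [->|/hpi[_ /gsE //]] := eqVneq c 0.
  by rewrite linear0 expr0n; apply: ideal0.
have hI := idl_ideal gs.
have [w [phi [hw hphi]]] := top_coordinate hchar hI hlam h1 hlt heq hpow.
have nullE c : phi (nseq k c) = 0 <-> in_ideal q (linform (c *m B) ^+ k).
  rewrite -gsE -lamE -prods_nseq; symmetry; apply: (phi_eq0 hI hw hphi).
  by rewrite size_nseq.
have cB (c : 'rV[K]_k) : c != 0 -> c *m B != 0 by apply: contra => /eqP/injB ->.
split.
  exists (power_form phi); split.
  - exact: (power_form_neq0 hchar hI hlam h1 hlt hw hphi).
  - exact: power_form_homog.
  - move=> c hc; rewrite -(power_formE hI hw hphi) nullE /in_Nk.
    by split=> [[]|h] //; split=> //; apply: cB.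
have [xs [sxs fxs nxs hxs]] := null_basis hchar hI hlam hnotin h1 hlt heq hpow hw hphi hk.
have rowX i : row i ((\matrix_(j < k) xs`_j) *m B) = xs`_i *m B by rewrite row_mul rowK.
exists ((\matrix_(j < k) xs`_j) *m B); split.
- apply: inj_row_free => v; rewrite mulmxA => /injB h.
  by apply: (row_free_inj (row_free_seq sxs fxs)); rewrite h mul0mx.
- move=> i; have hi : xs`_i \in xs by rewrite mem_nth // sxs.
  rewrite rowX submxMl; split=> //; split; last by apply/nullE/nxs.
  apply: cB; exact: (free_not0 fxs hi).
- rewrite -gsE => h; apply: hxs; rewrite /prods (big_nth 0) sxs big_mkord.
  by under eq_bigr => i _ do rewrite lamE -rowX.
Qed.
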